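(* Let $1\le k\le n-1$. The following properties hold. 1. The eigenvalues of $c_1\star$ acting on $\operatorname{QH}(\operatorname{Gr}(k,n))$ are given by $n(\zeta_1+\dots+\zeta_k)$, with $\{\zeta_1,\dots,\zeta_k\}$ varying among the size $k$ sets of (distinct) roots of $x^n=(-1)^{k+1}$. 2. Let $O(2)$ act on the complex plane by linear isometries of the Euclidean metric. The subgroup of $O(2)$ that maps the set of eigenvalues of $c_1\star$ to itself is isomorphic to the dihedral group $D_n$. 3. If $n=p$ is prime, then all eigenvalues of $c_1\star$ have multiplicity one.
   Context: $\operatorname{QH}(\operatorname{Gr}(k,n))$ is the small quantum cohomology ring of the complex Grassmannian of $k$-planes in $\mathbb{C}^n$, over $\mathbb{C}$, with quantum parameter $q=1$. As a vector space it is $H^\bullet(\operatorname{Gr}(k,n);\mathbb{C})$, with basis the Schubert classes $\sigma_d$ indexed by Young diagrams $d=(d_1\ge\dots\ge d_k)$ with $n-k\ge d_1$, $d_k\ge 0$. The operator $c_1\star$ is quantum multiplication by $c_1(T\operatorname{Gr}(k,n))=n\sigma_\square$, and is determined by the quantum Pieri rule $\sigma_\square\star\sigma_d=\sum_{d'}\sigma_{d'}+\sigma_{\hat d}$. Here $d'$ runs over diagrams in the $k\times(n-k)$ grid obtained by adding one box to $d$. The diagram $\hat d$ is obtained by erasing the first row and first column of $d$ if these are full (i.e. of length $n-k$ and $k$ respectively), and otherwise $\sigma_{\hat d}$ is replaced by $0$. The dihedral group is $D_n=\langle r,s\mid r^n=s^2=1,\ rs=sr^{-1}\rangle$, of order $2n$.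 *)

(* Defs.v *)
From HB Require Import structures.
From mathcomp Require Import all_boot all_order all_algebra all_fingroup all_solvable.
From mathcomp Require Import finmap complex.
From mathcomp Require Import all_classical all_reals.

Set Implicit Arguments.
Unset Strict Implicit.
Unset Printing Implicit Defensive.

Import GRing.Theory.

Local Open Scope ring_scope.
Local Open Scope complex_scope.
Local Open Scope classical_set_scope.

Section YoungDiagrams.
Variables k m : nat.

(* Diagrams in the k x m grid; d i is the length of row i, counted from 0. *)
Definition is_young (d : {ffun 'I_k -> 'I_m.+1}) : bool :=
  [forall i : 'I_k, forall j : 'I_k, (i <= j)%N ==> (d j <= d i)%N].

Record young : Type :=
  Young { young_fun : {ffun 'I_k -> 'I_m.+1}; _ : is_young young_fun }.

HB.instance Definition _ := [isSub for young_fun].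
HB.instance Definition _ := [Finite of young by <:].

(* Rows beyond the k-th have length 0. *)
Definition row_len (d : young) (i : nat) : nat :=
  if insub i is Some j then young_fun d j else 0%N.

Definition adds_box (d d' : young) : bool :=
  [exists i : 'I_k, [forall j : 'I_k, row_len d' j == (row_len d j + (j == i))%N]].

Definition full_hook (d : young) : bool :=
  (row_len d 0 == m) && [forall i : 'I_k, (0 < row_len d i)%N].

Definition erase_hook_fun (d : young) : {ffun 'I_k -> 'I_m.+1} :=
  [ffun i : 'I_k => inord (row_len d i.+1).-1].

Lemma row_len_leq (d : young) (i : nat) : (row_len d i <= m)%N.
Proof.
by rewrite /row_len; case: insubP => // j _ _; rewrite -ltnS ltn_ord.
Qed.

Lemma row_len_anti (d : young) (i j : nat) :
  (i <= j)%N -> (row_len d j <= row_len d i)%N.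
Proof.
move=> le_ij; rewrite /row_len; case: insubP => // j' lt_jk Ej.
rewrite insubT ?(leq_ltn_trans le_ij) // => lt_ik.
have /forallP/(_ (Sub i lt_ik))/forallP/(_ j')/implyP := valP d.
by apply; rewrite /= -Ej in le_ij *.
Qed.

Lemma erase_hook_subproof (d : young) : is_young (erase_hook_fun d).
Proof.
apply/forallP => i; apply/forallP => j; apply/implyP => le_ij.
have lt_m l : ((row_len d l).-1 < m.+1)%N.
  by rewrite ltnS (leq_trans (leq_pred _)) ?row_len_leq.
rewrite !ffunE !inordK // -!subn1 leq_sub2r // row_len_anti //.
Qed.

Definition erase_hook (d : young) : young :=
  Young (erase_hook_subproof d).

End YoungDiagrams.

(* The space underlying QH(Gr(k, n)) at q = 1, in Schubert coordinates. *)
Notation QH R k n := ('rV[R[i]]_#|{: young k (n - k)}|).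

Section QuantumCohomology.
Variables (R : realType) (k n : nat).

Local Notation diagram := (young k (n - k)).

Definition schubert (d : diagram) : QH R k n := delta_mx 0 (enum_rank d).

(* sigma_box * sigma_d, by the quantum Pieri rule *)
Definition quantum_pieri (d : diagram) : QH R k n :=
  \sum_(d' : diagram | adds_box d d') schubert d'
  + (if full_hook d then schubert (erase_hook d) else 0).

Definition sigma_box_star (v : QH R k n) : QH R k n :=
  \sum_(d : diagram) v 0 (enum_rank d) *: quantum_pieri d.

Definition c1_star (v : QH R k n) : QH R k n := n%:R *: sigma_box_star v.

Lemma c1_star_is_linear : linear c1_star.
Proof.
move=> a u v; rewrite /c1_star.
suff -> : sigma_box_star (a *: u + v) = a *: sigma_box_star u + sigma_box_star v.
  by rewrite scalerDr !scalerA mulrC.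
rewrite /sigma_box_star scaler_sumr -big_split /=; apply: eq_bigr => d _.
by rewrite !mxE scalerDl scalerA.
Qed.

HB.instance Definition _ :=
  GRing.isLinear.Build R[i] (QH R k n) (QH R k n) *:%R c1_star c1_star_is_linear.

(* MathComp matrices act on row vectors: v *m c1_star_mx = c1_star v. *)
Definition c1_star_mx : 'M[R[i]]_#|{: diagram}| := lin1_mx c1_star.

Definition c1_spectrum : set R[i] := [set a | eigenvalue c1_star_mx a].

(* algebraic multiplicity *)
Definition c1_multiplicity (a : R[i]) : nat := mup a (char_poly c1_star_mx).

Definition root_set (Z : {fset R[i]}) : Prop :=
  #|` Z| = k /\ {in Z, forall z, z ^+ n = (-1) ^+ k.+1}.

End QuantumCohomology.

Arguments c1_spectrum R k n : clear implicits.
Arguments c1_multiplicity R k n a : clear implicits.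

Section OrthogonalGroup.
Variable R : realType.

Definition O2 : set 'M[R]_2 := [set A | A *m A^T = 1%:M].

Definition O2_act (A : 'M[R]_2) (z : R[i]) : R[i] :=
  let: x +i* y := z in
  (A 0 0 * x + A 0 1 * y) +i* (A 1 0 * x + A 1 1 * y).

Definition O2_stabilizer (S : set R[i]) : set 'M[R]_2 :=
  [set A | O2 A /\ O2_act A @` S = S].

(* A finite group gT is isomorphic to a group G of matrices under *m. *)
Definition mx_group_isog (gT : finGroupType) (G : set 'M[R]_2) : Prop :=
  exists phi : gT -> 'M[R]_2,
    [/\ injective phi,
        forall x y : gT, phi (x * y)%g = phi x *m phi y
      & range phi = G].

End OrthogonalGroup.

(* Main.v *)
Require Import Defs.
From mathcomp Require Import all_boot all_order all_algebra all_fingroup all_solvable.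
From mathcomp Require Import finmap complex.
From mathcomp Require Import all_classical all_reals.
From mathcomp Require Import trigo.
From mathcomp Require Import zify ring lra.

Set Implicit Arguments.
Unset Strict Implicit.
Unset Printing Implicit Defensive.

Import Order.TTheory GRing.Theory Num.Theory.
Local Open Scope ring_scope.

(** A diagram d in the k x m grid, with n = k + m, is the same thing as k beads
    on the sites 0, ..., n - 1: row i (from 0) sits at d_i + (k - 1 - i).  Adding
    a box moves one bead one site up.  If the n sites are arranged in a circle,
    erasing a full hook moves a bead from site n - 1 on to site 0.  So
    sigma_box acts on QH(Gr(k, n)) as the cyclic shift acts on the k-th
    exterior power of an n-dimensional space, up to the sign (-1)^(k-1) that
    brings the wrapped bead to its place.  A shift twisted by that sign has the
    roots of x^n = (-1)^(k+1) as its eigenvalues, and the eigenvalues on the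
    exterior power are the sums of k distinct ones.

    Concretely, let x_1, ..., x_k be such roots.  The alternants
    det (x_a ^ bead_b(d)), which are Schur polynomials times a Vandermonde
    determinant, satisfy the quantum Pieri rule with eigenvalue x_1 + ... + x_k
    ([quantum_pieri_alternant]): multiplying a determinant by x_1 + ... + x_k is
    the same as raising one column exponent at a time, a forbidden move
    produces two equal columns, and x^n = (-1)^(k+1) handles the wrapped bead.
    The k-sets of roots are again indexed by diagrams, and the square matrix of
    alternants is invertible by the orthogonality of the powers of roots of
    unity together with the Cauchy-Binet expansion ([alternant_free]).  It
    diagonalizes c_1, which gives the characteristic polynomial with all
    multiplicities ([char_poly_c1]) and the first claim.

    For n = p prime, two k-sets of roots with equal sums give a polynomial over
    Q of degree less than p that vanishes at a primitive p-th root of unity and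
    at 1.  The cyclotomic polynomial being irreducible, it is 0
    ([prime_root_poly_eq0]), and the k-sets agree.  The eigenvalues are thus
    distinct.

    For the symmetries, the spectrum is stable under conjugation and under
    rotation by 2 pi / n, which gives 2 n isometries.  There are no others: an
    isometry that preserves the spectrum permutes its elements of maximal
    modulus, and these are exactly the n rotations of the positive number
    n (z_1 + ... + z_k) with z_1, ..., z_k consecutive roots placed symmetrically
    about the positive real axis ([spectrum_max_modulus]).  An isometry that
    sends this number to one of its rotations is that rotation, possibly
    preceded by the conjugation. *)

(** * Alternants *)

Section Alternants.
Variables (K : comNzRingType) (k : nat).
Implicit Types (x : 'I_k -> K) (e : 'I_k -> nat).

(** The numerator of the bialternant formula: for decreasing exponents it is a
    Schur polynomial times the Vandermonde determinant. *)
Definition alternant x e : K := \det (\matrix_(a, b) x a ^+ e b).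

Lemma eq_alternant x e e' : e =1 e' -> alternant x e = alternant x e'.
Proof.
by move=> eq_e; congr (\det _); apply/matrixP => a b; rewrite !mxE eq_e.
Qed.

(** The trace acts as a derivation on determinants.  In the Leibniz expansion
    the term of a permutation s, with one exponent raised in column b, is
    multiplied by x_(s^-1 b), and these factors add up to the sum of all x_a. *)
Lemma sum_mul_alternant x e :
  (\sum_a x a) * alternant x e
    = \sum_b alternant x (fun c => (e c + (c == b))%N).
Proof.
under [RHS]eq_bigr => b _ do rewrite /alternant /determinant.
rewrite exchange_big /= mulr_sumr; apply: eq_bigr => s _.
rewrite -mulr_sumr mulrCA; congr (_ * _).
rewrite mulr_suml (reindex_inj (@perm_inj _ s^-1%g)) /=; apply: eq_bigr => b _.
under [RHS]eq_bigr => a _ do rewrite mxE exprD.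
rewrite big_split /= mulrC; congr (_ * _).
  by apply: eq_bigr => a _; rewrite mxE.
rewrite (bigD1 (s^-1%g b)) //= permKV eqxx expr1 big1 ?mulr1 // => a ne_a.
by rewrite -(inj_eq (@perm_inj _ s^-1%g)) permK (negPf ne_a) expr0.
Qed.

Lemma alternant_eq0 x e b c : b != c -> e b = e c -> alternant x e = 0.
Proof.
move=> ne_bc eq_e; rewrite /alternant -det_tr.
by apply: (determinant_alternate ne_bc) => a; rewrite !mxE eq_e.
Qed.

End Alternants.

(** Rotating the k columns by one place costs (-1)^(k-1), which is exactly the
    sign by which x ^ n differs from x ^ 0.  The two Laplace expansions, along the
    first and the last column, have the same minors. *)
Lemma alternant_wrap (K : comNzRingType) (k n : nat) (x : 'I_k -> K)
    (e : nat -> nat) :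
    (forall a, x a ^+ n = (-1) ^+ k.+1) -> e k = 0%N ->
  alternant x (fun c => if c == 0 :> nat then n else e c)
    = alternant x (fun c => e c.+1).
Proof.
case: k x => [|k] x xn ek; first by rewrite /alternant !det_mx00.
rewrite /alternant (expand_det_col _ ord0) [RHS](expand_det_col _ ord_max).
apply: eq_bigr => a _; rewrite !mxE /= xn ek expr0 mul1r /cofactor.
rewrite mulrA -exprD /= addn0 !addSn !exprS !mulN1r opprK addnC.
by congr (_ * \det _); apply/matrixP => i j; rewrite !mxE lift_max lift0.
Qed.

(** * Young diagrams as bead configurations *)

Section Beads.
Variables k m : nat.
Implicit Types d : young k m.

(** Row lengths only decrease weakly; the added staircase makes them strictly
    decreasing, so that a diagram becomes a k-subset of {0, ..., k + m - 1}. *)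
Definition bead d (i : nat) : nat := (row_len d i + (k - i.+1))%N.

Lemma row_lenE d (i : 'I_k) : row_len d i = young_fun d i.
Proof. by rewrite /row_len; case: insubP => [j _ /val_inj-> //|/negP[]]. Qed.

Lemma bead_lt d (i : 'I_k) : (bead d i < k + m)%N.
Proof.
have := row_len_leq d i; have := ltn_ord i; rewrite /bead; lia.
Qed.

Lemma bead_decr d (i j : 'I_k) : (i < j)%N -> (bead d j < bead d i)%N.
Proof.
move=> lt_ij; have := row_len_anti d (ltnW lt_ij); have := ltn_ord j.
by rewrite /bead; lia.
Qed.

Lemma bead_inj d (i j : 'I_k) : bead d i = bead d j -> i = j.
Proof.
move=> eq_ij; apply/val_inj; case: (ltngtP i j) => // /(bead_decr d);
by rewrite eq_ij ltnn.
Qed.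

Lemma young_row_inj d d' : (forall i : 'I_k, row_len d i = row_len d' i) -> d = d'.
Proof.
move=> eq_d; apply/val_inj/ffunP => i; apply/val_inj.
by rewrite /= -!row_lenE.
Qed.

Lemma young_of_rows (f : 'I_k -> nat) :
    (forall i, f i <= m)%N -> (forall i j : 'I_k, i <= j -> f j <= f i)%N ->
  exists d, forall i : 'I_k, row_len d i = f i.
Proof.
move=> f_le f_anti.
have yP : is_young [ffun i : 'I_k => inord (f i) : 'I_m.+1].
  apply/forallP => i; apply/forallP => j; apply/implyP => le_ij.
  by rewrite !ffunE !inordK ?ltnS // f_anti.
by exists (Young yP) => i; rewrite row_lenE /= ffunE inordK ?ltnS.
Qed.

(** Beads are listed in decreasing order, so a diagram is determined by the set
    of its beads; and k-sets of which one contains the other are equal. *)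
Lemma bead_sub_inj d d' :
  (forall i : 'I_k, exists j : 'I_k, bead d i = bead d' j) -> d = d'.
Proof.
move=> sub_dd'; pose s c := [seq bead c (i : 'I_k) | i <- enum 'I_k].
have s_uniq c : uniq (s c).
  by rewrite map_inj_in_uniq ?enum_uniq // => i j _ _; apply: bead_inj.
have s_sorted c : sorted gtn (s c).
  rewrite sorted_map; apply: (@sub_sorted _ (relpre val ltn)).
    by move=> i j; apply: bead_decr.
  by rewrite -sorted_map val_enum_ord iota_ltn_sorted.
have [||_ mem_s] := @uniq_min_size _ (s d) (s d') (s_uniq d).
- move=> _ /mapP[i _ ->]; have [j ->] := sub_dd' i.
  by apply/mapP; exists j; rewrite ?mem_enum.
- by rewrite !size_map.
have /eq_in_map eq_s : s d = s d'.
  apply: (@irr_sorted_eq _ gtn) => //.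
    by move=> y x z /= ? /ltn_trans; apply.
  by move=> x /=; rewrite ltnn.
apply: young_row_inj => i; have := eq_s i (mem_enum _ _).
by rewrite /bead => /addIn.
Qed.

(** Sort f decreasingly, by sending i to the number of larger values, and
    remove the staircase.  The sorted values drop by at least one at each step,
    which keeps the row lengths between 0 and m. *)
Lemma bead_surj (f : 'I_k -> nat) :
    injective f -> (forall i, f i < k + m)%N ->
  exists d, exists s : {perm 'I_k}, forall i, f i = bead d (s i).
Proof.
move=> f_inj f_lt.
have rank_lt i : (#|[set j | f i < f j]| < k)%N.
  rewrite -[X in (_ < X)%N](card_ord k) -cardsT proper_card //.
  by apply/fintype.properP; split; [apply/fintype.subsetP | exists i; rewrite ?inE ?ltnn].
pose rank i := Ordinal (rank_lt i).
have rank_mono i j : (f i < f j)%N -> (rank j < rank i)%N.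
  move=> lt_ij; apply: proper_card; apply/fintype.properP; split.
    by apply/fintype.subsetP => l; rewrite !inE; apply: ltn_trans.
  by exists j; rewrite !inE ?ltnn.
have rank_inj : injective rank.
  move=> i j eq_ij; apply: f_inj.
  by case: (ltngtP (f i) (f j)) => // /rank_mono; rewrite eq_ij ltnn.
pose s := perm rank_inj; pose g i := f (s^-1%g i).
have g_decr (i j : 'I_k) : (i < j)%N -> (g j < g i)%N.
  move=> lt_ij; have si : rank (s^-1%g i) = i by rewrite -permE permKV.
  have sj : rank (s^-1%g j) = j by rewrite -permE permKV.
  rewrite /g ltnNge; apply/negP; rewrite leq_eqVlt => /predU1P[/f_inj eq_f|].
    by move: lt_ij; rewrite -si -sj eq_f ltnn.
  by move/rank_mono; rewrite si sj => /ltn_trans/(_ lt_ij); rewrite ltnn.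
have g_gap c (i j : 'I_k) : (j = i + c :> nat)%N -> (g j + c <= g i)%N.
  elim: c j => [|c IHc] j Ej.
    by rewrite addn0; have -> : j = i by apply/val_inj; rewrite /= Ej addn0.
  have lt_ick : (i + c < k)%N by have := ltn_ord j; rewrite Ej; lia.
  have := IHc (Ordinal lt_ick) erefl.
  by have := @g_decr (Ordinal lt_ick) j; rewrite /= Ej; lia.
have [] := @young_of_rows (fun i => g i - (k - i.+1))%N.
- move=> i; have k_gt0 : (0 < k)%N by apply: leq_trans (ltn_ord i).
  have := g_gap i (Ordinal k_gt0) i erefl.
  by have := f_lt (s^-1%g (Ordinal k_gt0)); rewrite -/(g _); lia.
- move=> i j le_ij; have := g_gap _ i j (esym (subnKC le_ij)); by have := ltn_ord j; lia.
move=> d row_d; exists d; exists s => i; rewrite /bead row_d /g permK.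
have lt_kk : (k.-1 < k)%N by have := ltn_ord (s i); lia.
have le_sk : (s i <= Ordinal lt_kk)%N by have := ltn_ord (s i) => /=; lia.
have := g_gap _ _ _ (esym (subnKC le_sk)).
rewrite /g permK /= => le_f; rewrite subnK //; apply: leq_trans le_f.
by rewrite subnS predn_sub leq_addl.
Qed.

End Beads.

(** * The quantum Pieri rule for alternants *)

Section QuantumPieri.
Variables (K : comNzRingType) (k m : nat) (x : 'I_k -> K).
Hypotheses (k_gt0 : (0 < k)%N) (m_gt0 : (0 < m)%N).
Hypothesis x_root : forall a, x a ^+ (k + m) = (-1) ^+ k.+1.
Implicit Types d : young k m.

Let top : 'I_k := Ordinal k_gt0.

(** Unlike [adds_box], this records the row that receives the box, that is the
    column of the alternant whose exponent is raised. *)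
Definition adds_box_at d (b : 'I_k) d' :=
  [forall j : 'I_k, row_len d' j == (row_len d j + (j == b))%N].

Lemma adds_box_atP d b d' :
  reflect (forall j : 'I_k, row_len d' j = (row_len d j + (j == b))%N)
          (adds_box_at d b d').
Proof. exact: 'forall_eqP. Qed.

Lemma adds_box_at_inj d b d1 d2 :
  adds_box_at d b d1 -> adds_box_at d b d2 -> d1 = d2.
Proof.
by move=> /adds_box_atP r1 /adds_box_atP r2; apply: young_row_inj => i; rewrite r1.
Qed.

Lemma adds_box_at_row d b c d' : adds_box_at d b d' -> adds_box_at d c d' -> b = c.
Proof.
move=> /adds_box_atP/(_ b) dd'b /adds_box_atP/(_ b); rewrite dd'b eqxx.
by move=> /addnI; case: eqVneq.
Qed.

Lemma sum_adds_box d (F : young k m -> K) :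
  \sum_(d' | adds_box d d') F d' = \sum_b \sum_(d' | adds_box_at d b d') F d'.
Proof.
under [RHS]eq_bigr do rewrite big_mkcond.
rewrite exchange_big /= big_mkcond; apply: eq_bigr => d' _.
have -> : adds_box d d' = [exists b, adds_box_at d b d'] by [].
case: ifPn => [/existsP[b dd'] | /existsPn no_b]; last first.
  by rewrite big1 // => b _; rewrite (negPf (no_b b)).
rewrite (bigD1 b) //= dd' big1 ?addr0 // => c; apply: contraNeq.
by case: ifP => [/(adds_box_at_row dd')-> // | ]; rewrite eqxx.
Qed.

Lemma adds_box_at_ex d (b : 'I_k) :
    (row_len d b < if b == top then m else row_len d b.-1)%N ->
  exists d', adds_box_at d b d'.
Proof.
move=> addable.
have [||d' d'E] := @young_of_rows k m (fun j : 'I_k => row_len d j + (j == b))%N.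
- move=> i; case: eqP => [->|_]; last by rewrite addn0 row_len_leq.
  rewrite addn1; move: addable; case: ifP => // _ /leq_trans; apply.
  exact: row_len_leq.
- move=> i j le_ij; have := row_len_anti d le_ij.
  have [Ej|_] := eqVneq j b; last by lia.
  have [//|ne_ib] := eqVneq i b; first by rewrite Ej; lia.
  have lt_ib : (i < b)%N by rewrite ltn_neqAle ne_ib /= -Ej.
  move: addable; have -> : (b == top) = false by apply/eqP => /(congr1 val) /=; lia.
  have := @row_len_anti _ _ d i b.-1; rewrite Ej; lia.
by exists d'; apply/adds_box_atP.
Qed.

(** If row b can receive a box, raising its exponent gives the alternant of the
    larger diagram.  Otherwise either b is not the first row and row b - 1 has the
    same length, whence two equal columns; or b is the first row and is full, and
    the exponent k + m is wrapped around to 0.  In that last case the result is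
    the diagram without its hook, unless the site 0 was occupied already. *)
Lemma alternant_step d (b : 'I_k) :
  \sum_(d' | adds_box_at d b d') alternant x (bead d')
    + (if (b == top) && full_hook d then alternant x (bead (erase_hook d)) else 0)
  = alternant x (fun c => bead d c + (c == b))%N.
Proof.
have [addable | blocked] :=
  ltnP (row_len d b) (if b == top then m else row_len d b.-1).
  have [d' dd'] := adds_box_at_ex addable.
  rewrite (big_pred1 d'); last first.
    by move=> c; apply/idP/eqP => [/adds_box_at_inj/(_ dd') | ->].
  have -> : (b == top) && full_hook d = false.
    case: eqP addable => //= ->; rewrite /full_hook => lt_m.
    by rewrite eqn_leq [(m <= _)%N]leqNgt lt_m andbF.
  rewrite addr0; apply: eq_alternant => c.
  by rewrite /bead; have /adds_box_atP-> := dd'; rewrite addnAC.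
rewrite big_pred0 ?add0r; last first.
  move=> d'; apply/negP => /adds_box_atP row_d'; move: blocked.
  have := row_d' b; rewrite eqxx; case: (eqVneq b top) => [->|ne_b] row_b.
    by have := row_len_leq d' top; lia.
  have b_gt0 : (0 < b)%N by rewrite lt0n; apply: contraNneq ne_b => b0; apply/eqP/val_inj.
  have lt_b1 : (b.-1 < k)%N by have := ltn_ord b; lia.
  have := row_d' (Ordinal lt_b1); have := row_len_anti d' (leq_pred b).
  rewrite -val_eqE /=; lia.
have [Eb|ne_b] := eqVneq b top; last first.
  have b_gt0 : (0 < b)%N by rewrite lt0n; apply: contraNneq ne_b => b0; apply/eqP/val_inj.
  have lt_b1 : (b.-1 < k)%N by have := ltn_ord b; lia.
  have ne_b1 : Ordinal lt_b1 != b by rewrite -val_eqE /=; lia.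
  rewrite /= (alternant_eq0 _ ne_b1) // eqxx (negPf ne_b1) /bead /=.
  move: blocked; rewrite (negPf ne_b).
  by have := row_len_anti d (leq_pred b); have := ltn_ord b; lia.
rewrite {b}Eb eqxx /= in blocked *.
have row0 : row_len d 0 = m by apply/eqP; rewrite eqn_leq row_len_leq blocked.
(* Since bead d k = 0, the column after the last one stands for the bead that
   has been wrapped around to site 0. *)
have -> : alternant x (fun c => bead d c + (c == top))%N
        = alternant x (fun c => bead d c.+1).
  rewrite -(alternant_wrap x_root) ?/bead; last first.
    by rewrite /row_len insubF ?ltnn //; lia.
  apply: eq_alternant => c; rewrite -(inj_eq val_inj) /=.
  by case: eqP => [->|_]; rewrite ?row0 ?addn0 //; lia.
rewrite /full_hook row0 eqxx /=; case: ifPn => [/forallP pos | /forallPn[j]].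
  apply: eq_alternant => c; rewrite /bead row_lenE /= ffunE inordK; last first.
    by rewrite ltnS (leq_trans (leq_pred _)) ?row_len_leq.
  have [lt_ck|le_kc] := ltnP c.+1 k.
    by have := pos (Ordinal lt_ck) => /=; lia.
  have -> : row_len d c.+1 = 0%N by rewrite /row_len insubF // ltnNge le_kc.
  by lia.
rewrite -leqNgt leqn0 => /eqP row_j.
(* An empty last row puts a bead on site 0, where it collides with the wrapped
   one; these are two beads because the first row, of length m > 0, is not empty. *)
have lt_k1 : (k.-1 < k)%N by lia.
have row_last : row_len d k.-1 = 0%N.
  by have := @row_len_anti _ _ d j k.-1; have := ltn_ord j; lia.
have k_gt1 : (1 < k)%N.
  rewrite ltnNge; apply/negP => le_k1; move: row_last.
  by rewrite (_ : k.-1 = 0%N) ?row0; lia.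
have lt_k2 : (k.-2 < k)%N by lia.
rewrite (@alternant_eq0 _ _ _ _ (Ordinal lt_k1) (Ordinal lt_k2)) //.
  by rewrite -val_eqE /=; lia.
have Ek1 : k.-1.+1 = k by lia.
have Ek2 : k.-2.+1 = k.-1 by lia.
rewrite /bead /= Ek2 Ek1 row_last.
by rewrite /row_len insubF ?ltnn //; lia.
Qed.

(** This says that sending each Schubert class to its alternant at x is an
    eigenvector, for the eigenvalue x_1 + ... + x_k, of the transpose of
    multiplication by sigma_box. *)
Theorem quantum_pieri_alternant d :
  \sum_(d' | adds_box d d') alternant x (bead d')
    + (if full_hook d then alternant x (bead (erase_hook d)) else 0)
  = (\sum_a x a) * alternant x (bead d).
Proof.
rewrite sum_mul_alternant sum_adds_box.
under [RHS]eq_bigr => b _ do rewrite -alternant_step.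
rewrite big_split /=; congr (_ + _).
rewrite (bigD1 top) //= big1 ?addr0 // => b ne_b.
by rewrite (negPf ne_b).
Qed.

End QuantumPieri.

(** * Linear independence of the alternants *)

Lemma alternant_perm (K : comNzRingType) (k : nat) (x : 'I_k -> K)
    (e : 'I_k -> nat) (s : {perm 'I_k}) :
  alternant x (fun c => e (s c)) = (-1) ^+ s * alternant x e.
Proof.
rewrite mulrC -odd_permV -det_perm -det_mulmx -col_permE.
by congr (\det _); apply/matrixP => a b; rewrite !mxE.
Qed.

(** The Cauchy-Binet formula before the row maps f are grouped by image; the
    non-injective f contribute 0. *)
Lemma det_mulmx_expand (K : comNzRingType) (k n : nat) (A : 'M[K]_(k, n))
    (B : 'M[K]_(n, k)) :
  \det (A *m B) = \sum_(f : {ffun 'I_k -> 'I_n})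
                    (\prod_a A a (f a)) * \det (\matrix_(a, b) B (f a) b).
Proof.
rewrite /determinant.
under [RHS]eq_bigr => f _ do rewrite mulr_sumr.
rewrite exchange_big /=; apply: eq_bigr => s _.
under eq_bigr => a _ do rewrite mxE.
rewrite bigA_distr_bigA mulr_sumr; apply: eq_bigr => f _.
rewrite mulrCA -big_split; congr (_ * _); apply: eq_bigr => a _.
by rewrite !mxE.
Qed.

Lemma sum_expr_root1 (K : idomainType) (n : nat) (u : K) :
  u ^+ n = 1 -> u != 1 -> \sum_(j < n) u ^+ j = 0.
Proof.
move=> un1 u_neq1; apply/eqP; have /eqP := subrX1 u n.
by rewrite un1 subrr eq_sym mulf_eq0 subr_eq0 (negPf u_neq1).
Qed.

Lemma sign_root_neq0 (K : idomainType) (n l : nat) (z : K) :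
  (0 < n)%N -> z ^+ n = (-1) ^+ l -> z != 0.
Proof.
move=> n_gt0 zn; apply/eqP => z00; move/eqP: zn.
by rewrite z00 expr0n gtn_eqF // eq_sym signr_eq0.
Qed.

Lemma prim_root_neq0 (K : idomainType) (n : nat) (w : K) :
  n.-primitive_root w -> w != 0.
Proof.
move=> w_prim; apply/eqP => w0; have /eqP := prim_expr_order w_prim.
by rewrite w0 expr0n gtn_eqF ?(prim_order_gt0 w_prim) // eq_sym oner_eq0.
Qed.

Section Eigenbasis.
Variables (K : fieldType) (k m : nat) (w z0 : K).
Hypotheses (w_prim : (k + m).-primitive_root w) (z0_neq0 : z0 != 0).
Hypothesis n_neq0 : (k + m)%:R != 0 :> K.
Implicit Types d e : young k m.
Local Notation n := (k + m)%N.

(** If z0 is one root of x^n = (-1)^(k+1), the sites 0, ..., n - 1 label all the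
    roots z0 * w ^ j, and a diagram picks those at its beads. *)
Definition bead_point d (a : 'I_k) : K := z0 * w ^+ bead d a.

Let w_neq0 : w != 0. Proof. exact: prim_root_neq0 w_prim. Qed.

(** Orthogonality of the characters of Z/n, restricted to two sets of roots. *)
Lemma bead_gram e' e :
  (\matrix_(a < k, j < n) (bead_point e' a)^-1 ^+ j)
      *m (\matrix_(j < n, b < k) bead_point e b ^+ j)
  = \matrix_(a, b) (if bead e' a == bead e b then n%:R else 0).
Proof.
apply/matrixP => a b; rewrite !mxE.
under eq_bigr => j _ do rewrite !mxE -exprMn mulrC.
have -> : bead_point e b / bead_point e' a = w ^+ bead e b / w ^+ bead e' a.
  by rewrite /bead_point invfM mulrACA divff ?mul1r.
case: eqP => [->|/eqP ne_ab].
  rewrite divff ?expf_neq0 //.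
  under eq_bigr do rewrite expr1n.
  by rewrite sumr_const card_ord.
apply: sum_expr_root1.
  by rewrite expr_div_n -!exprM ![(_ * n)%N]mulnC !exprM (prim_expr_order w_prim)
             !expr1n divr1.
apply: contra ne_ab => /eqP eq1; rewrite -(modn_small (bead_lt e' a)).
rewrite -(modn_small (bead_lt e b)) -(eq_prim_root_expr w_prim) eq_sym.
by rewrite -(divfK (expf_neq0 (bead e' a) w_neq0) (w ^+ bead e b)) eq1 mul1r.
Qed.

Lemma det_bead_gram e' e :
  \det (\matrix_(a < k, b < k) (if bead e' a == bead e b then n%:R else 0 : K))
    = if e' == e then n%:R ^+ k else 0.
Proof.
case: eqP => [->|ne_ee].
  rewrite -det_scalar; congr (\det _); apply/matrixP => a b; rewrite !mxE.
  by rewrite (inj_eq (@bead_inj _ _ e)); case: eqP.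
have [a no_b] : exists a : 'I_k, forall b : 'I_k, bead e' a != bead e b.
  apply: contrapT => no_a; apply/ne_ee/bead_sub_inj => a.
  apply: contrapT => no_b; apply: no_a; exists a => b.
  by apply/eqP => eq_ab; apply: no_b; exists b.
rewrite (expand_det_row _ a) big1 // => b _.
by rewrite mxE (negPf (no_b b)) mul0r.
Qed.

(** Pair the relation with the configuration e': by [det_mulmx_expand] and
    [bead_gram] the coefficients survive only at e', with the factor n ^ k.  The
    expansion runs over all row maps f, whereas the hypothesis speaks of diagrams
    only; a non-injective f gives 0 and an injective one is a diagram up to the
    order of its beads. *)
Lemma alternant_free (c : young k m -> K) :
    (forall d, \sum_e c e * alternant (bead_point e) (bead d) = 0) ->
  forall e, c e = 0.
Proof.
move=> c0 e'.
have c0' (f : 'I_k -> 'I_n) : \sum_e c e * alternant (bead_point e) f = 0.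
  have [f_inj | /injectivePn[i [j ne_ij eq_f]]] := boolP (injectiveb f).
    have [| a |d [s fE]] := @bead_surj k m (fun a => f a); last first.
    - under eq_bigr => e _.
        rewrite (eq_alternant _ fE) (alternant_perm _ (fun i : 'I_k => bead d i)) mulrCA.
        over.
      by rewrite -mulr_sumr c0 mulr0.
    - exact: ltn_ord.
    - by move=> a b /val_inj; apply/injectiveP.
  by rewrite big1 // => e _; rewrite (alternant_eq0 _ ne_ij) ?mulr0 ?eq_f.
have : \sum_e c e * (if e' == e then n%:R ^+ k else 0) = 0.
  under eq_bigr => e _ do
    rewrite -det_bead_gram -bead_gram det_mulmx_expand mulr_sumr.
  rewrite exchange_big big1 //= => f _.
  transitivity ((\prod_a (bead_point e' a)^-1 ^+ f a)
                  * \sum_e c e * alternant (bead_point e) (fun a => f a)).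
    rewrite mulr_sumr; apply: eq_bigr => e _; rewrite mulrCA; congr (_ * (_ * _)).
      by apply: eq_bigr => a _; rewrite mxE.
    rewrite /alternant -det_tr; congr (\det _).
    by apply/matrixP => a b; rewrite !mxE.
  by rewrite (c0' f) mulr0.
rewrite (bigD1 e') //= eqxx big1 ?addr0 => [|e /negPf]; last first.
  by rewrite eq_sym => ->; rewrite mulr0.
by move/eqP; rewrite mulf_eq0 expf_eq0 (negPf n_neq0) andbF orbF => /eqP.
Qed.

End Eigenbasis.

(** * Diagonalization of quantum multiplication by the first Chern class *)

Lemma char_poly_diagonalized (K : fieldType) (N : nat) (M P : 'M[K]_N)
    (D : 'rV[K]_N) :
    P \in unitmx -> M *m P = P *m diag_mx D ->
  char_poly M = \prod_i ('X - (D 0 i)%:P).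
Proof.
move=> P_unit MP.
have <- : char_poly (diag_mx D) = \prod_i ('X - (D 0 i)%:P).
  rewrite char_poly_trig ?diag_mx_is_trig //.
  by apply: eq_bigr => i _; rewrite mxE eqxx.
have detP : \det (map_mx polyC P) != 0.
  by rewrite det_map_mx polyC_eq0 -unitfE -unitmxE.
apply: (mulIf detP); rewrite /char_poly -det_mulmx mulrC -det_mulmx.
rewrite /char_poly_mx mulmxBl mulmxBr -!map_mxM MP.
by rewrite mul_scalar_mx mul_mx_scalar.
Qed.

Section Diagonalization.
Variables (R : realType) (k n : nat) (w z0 : R[i]).
Hypotheses (k_gt0 : (0 < k)%N) (k_lt : (k < n)%N).
Hypotheses (w_prim : n.-primitive_root w) (z0n : z0 ^+ n = (-1) ^+ k.+1).
Local Notation diagram := (young k (n - k)).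
Implicit Types d e : diagram.

Let nE : (k + (n - k))%N = n. Proof. by rewrite subnKC // ltnW. Qed.
Let n_gt0 : (0 < n)%N. Proof. exact: leq_trans k_lt. Qed.

Let z0_neq0 : z0 != 0. Proof. exact: sign_root_neq0 n_gt0 z0n. Qed.

Definition c1_eigenvalue e : R[i] := n%:R * \sum_a bead_point w z0 e a.

(** Rows are Schubert classes and columns are k-sets of roots, both indexed by
    diagrams, so that invertibility makes sense without counting either. *)
Definition schur_mx : 'M[R[i]]_#|{: diagram}| :=
  \matrix_(i, j) alternant (bead_point w z0 (enum_val j)) (bead (enum_val i)).

Lemma schubert_schur d j :
  (schubert R d *m schur_mx) 0 j
    = alternant (bead_point w z0 (enum_val j)) (bead d).
Proof. by rewrite -rowE !mxE enum_rankK. Qed.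

Lemma c1_star_schur :
  c1_star_mx R k n *m schur_mx
    = schur_mx *m diag_mx (\row_j c1_eigenvalue (enum_val j)).
Proof.
apply/row_matrixP => i; rewrite [LHS]rowE mulmxA mul_rV_lin1 /= /c1_star.
rewrite -[i in delta_mx _ i]enum_valK -/(schubert R (enum_val i)).
set d := enum_val i.
have -> : sigma_box_star (schubert R d) = quantum_pieri R d.
  rewrite /sigma_box_star (bigD1 d) //= mxE !eqxx scale1r big1 ?addr0 // => e.
  by rewrite mxE (inj_eq enum_rank_inj) => /negPf->; rewrite andbF scale0r.
apply/rowP => j; rewrite mul_mx_diag -scalemxAl ![in RHS]mxE [LHS]mxE -/d.
rewrite /c1_eigenvalue [RHS]mulrC -mulrA.
congr (_ * _); rewrite -quantum_pieri_alternant ?subn_gt0 //; last first.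
  move=> a; rewrite /bead_point exprMn -exprM mulnC exprM nE.
  by rewrite (prim_expr_order w_prim) expr1n mulr1.
rewrite /quantum_pieri mulmxDl mxE mulmx_suml summxE; congr (_ + _).
  by apply: eq_bigr => d' _; rewrite schubert_schur.
by case: ifP; rewrite ?schubert_schur // mul0mx mxE.
Qed.

Lemma schur_mx_unit : schur_mx \in unitmx.
Proof.
rewrite -unitmx_tr -row_free_unit; apply: inj_row_free => v v0.
apply/rowP => j; rewrite [RHS]mxE -[j]enum_valK.
have w_prim' : (k + (n - k)).-primitive_root w by rewrite nE.
have nR_neq0 : (k + (n - k))%:R != 0 :> R[i] by rewrite nE pnatr_eq0 -lt0n.
apply: (alternant_free w_prim' z0_neq0 nR_neq0 (c := fun e => v 0 (enum_rank e))).
move=> d; move/rowP/(_ (enum_rank d)): v0; rewrite !mxE => v0.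
rewrite -[RHS]v0 [RHS](reindex (@enum_rank _)) /=; last exact/onW_bij/enum_rank_bij.
by apply: eq_bigr => e _; rewrite !mxE !enum_rankK.
Qed.

Lemma char_poly_c1 :
  char_poly (c1_star_mx R k n) = \prod_e ('X - (c1_eigenvalue e)%:P).
Proof.
rewrite (char_poly_diagonalized schur_mx_unit c1_star_schur).
rewrite [RHS](reindex (@enum_val _ {: diagram})) /=; last first.
  exact/onW_bij/enum_val_bij.
by apply: eq_bigr => i _; rewrite mxE.
Qed.

Lemma c1_spectrumP a :
  c1_spectrum R k n a <-> exists e, a = c1_eigenvalue e.
Proof.
rewrite /c1_spectrum /= eigenvalue_root_char char_poly_c1 rootE horner_prod.
split=> [/prodf_eq0[e _]|[e ->]].
  by rewrite -rootE root_XsubC => /eqP ->; exists e.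
by apply/prodf_eq0; exists e => //; rewrite -rootE root_XsubC.
Qed.

Lemma c1_multiplicity1 a :
  injective c1_eigenvalue -> c1_spectrum R k n a -> c1_multiplicity R k n a = 1%N.
Proof.
move=> ev_inj /c1_spectrumP[e ->]; rewrite /c1_multiplicity char_poly_c1.
rewrite (bigD1 e) //= mupMl.
  by rewrite -['X - _]expr1 mup_XsubCX eqxx.
rewrite rootE horner_prod; apply/prodf_neq0 => e' ne_e'.
by rewrite -rootE root_XsubC (inj_eq ev_inj) eq_sym.
Qed.

End Diagonalization.

(** * The spectrum as a set of sums of roots *)

Section RootFamilies.
Variables (K : fieldType) (k m : nat) (w z0 : K).
Hypotheses (w_prim : (k + m).-primitive_root w) (z0_neq0 : z0 != 0).

Lemma bead_point_inj (e : young k m) : injective (bead_point w z0 e).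
Proof.
move=> a b /(mulfI z0_neq0)/eqP; rewrite (eq_prim_root_expr w_prim).
by rewrite !modn_small ?bead_lt // => /eqP/bead_inj.
Qed.

Lemma bead_point_expr (e : young k m) a : bead_point w z0 e a ^+ (k + m) = z0 ^+ (k + m).
Proof.
by rewrite exprMn -exprM mulnC exprM (prim_expr_order w_prim) expr1n mulr1.
Qed.

Lemma root_family_beads (x : 'I_k -> K) :
    injective x -> (forall a, x a ^+ (k + m) = z0 ^+ (k + m)) ->
  exists e : young k m, exists s : {perm 'I_k}, forall a, x a = bead_point w z0 e (s a).
Proof.
move=> x_inj x_root.
have x_pow a : {j : 'I_(k + m) | x a / z0 = w ^+ j}.
  by apply: (prim_rootP w_prim); rewrite expr_div_n x_root divff ?expf_neq0.
pose f a : nat := sval (x_pow a).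
have xE a : x a = z0 * w ^+ f a.
  by rewrite /f -(svalP (x_pow a)) mulrC divfK.
have [||e [s fE]] := @bead_surj k m f.
- by move=> a b eq_f; apply: x_inj; rewrite !xE eq_f.
- by move=> a; apply: ltn_ord.
by exists e, s => a; rewrite xE fE.
Qed.

End RootFamilies.

Section Spectrum.
Variables (R : realType) (k n : nat) (w z0 : R[i]).
Hypotheses (k_gt0 : (0 < k)%N) (k_lt : (k < n)%N).
Hypotheses (w_prim : n.-primitive_root w) (z0n : z0 ^+ n = (-1) ^+ k.+1).

Let nE : (k + (n - k))%N = n. Proof. by rewrite subnKC // ltnW. Qed.
Let w_prim' : (k + (n - k)).-primitive_root w. Proof. by rewrite nE. Qed.
Let n_gt0 : (0 < n)%N. Proof. exact: leq_trans k_lt. Qed.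
Let z0_n0 : z0 != 0. Proof. exact: sign_root_neq0 n_gt0 z0n. Qed.

(** Families of distinct roots, rather than sets, are what rotations and
    conjugation act on most directly. *)
Lemma c1_spectrum_families a :
  c1_spectrum R k n a <->
    exists x : 'I_k -> R[i], [/\ injective x,
      forall b, x b ^+ n = (-1) ^+ k.+1 & a = n%:R * \sum_b x b].
Proof.
rewrite (c1_spectrumP k_gt0 k_lt w_prim z0n); split=> [[e ->]|[x [x_inj xn ->]]].
  exists (bead_point w z0 e); split=> //; first exact: bead_point_inj.
  by move=> b; have := bead_point_expr z0 w_prim' e b; rewrite nE z0n.
have [|e [s xE]] := @root_family_beads _ _ _ _ _ w_prim' z0_n0 x x_inj.
  by move=> b; rewrite nE xn z0n.
exists e; congr (_ * _); rewrite [RHS](reindex_inj (@perm_inj _ s)).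
by apply: eq_bigr => b _.
Qed.

End Spectrum.

Lemma root_sets_families (R : realType) (k n : nat) (a : R[i]) :
  (exists2 Z : {fset R[i]}, root_set k n Z & n%:R * \sum_(z <- Z) z = a) <->
  exists x : 'I_k -> R[i], [/\ injective x,
      forall b, x b ^+ n = (-1) ^+ k.+1 & a = n%:R * \sum_b x b].
Proof.
split=> [[Z [cardZ Zn] <-]|[x [x_inj xn ->]]].
  have x_in (b : 'I_k) : nth 0 Z b \in Z by rewrite mem_nth // cardZ.
  exists (fun b : 'I_k => nth 0 Z b); split.
  - move=> b c /eqP; rewrite nth_uniq ?fset_uniq ?cardZ //.
    by move=> /eqP/val_inj.
  - by move=> b; apply: Zn.
  - by rewrite (big_nth 0) big_mkord -cardZ.
pose Z := [fset x b | b in 'I_k]%fset; exists Z.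
  split; first by rewrite card_imfset //= -cardE card_ord.
  by move=> _ /imfsetP[b _ ->].
by congr (_ * _); rewrite big_imfset //= ?big_enum // => b c _ _ /x_inj.
Qed.

(** * Simplicity of the spectrum for prime n *)

Section PrimeRoots.
Variables (K : numFieldType) (p : nat) (w : K).
Hypotheses (p_prime : prime p) (w_prim : p.-primitive_root w).

(** The cyclotomic polynomial of the prime p evaluated at X + 1, that is
    ((X + 1) ^ p - 1) / X, to which Eisenstein's criterion applies. *)
Definition shifted_cyclotomic : {poly int} := \poly_(i < p) ('C(p, i.+1))%:R.

Lemma size_shifted_cyclotomic : size shifted_cyclotomic = p.
Proof.
rewrite size_poly_eq // prednK ?prime_gt0 //.
by rewrite binn.
Qed.

Lemma mulX_shifted_cyclotomic :
  'X * shifted_cyclotomic = ('X + 1) ^+ p - 1.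
Proof.
rewrite [X in X ^+ _]addrC exprDn big_ord_recl expr1n mul1r expr0 bin0 mulr1n.
rewrite addrC addKr /shifted_cyclotomic poly_def mulr_sumr.
apply: eq_bigr => i _.
by rewrite expr1n mul1r lift0 -scalerAr -exprS scaler_nat.
Qed.

Lemma shifted_cyclotomic_irreducible :
  irreducible_poly (map_poly intr shifted_cyclotomic : {poly rat}).
Proof.
apply/irreducible_rat_int/(eisenstein_crit p_prime).
- by rewrite size_shifted_cyclotomic; case: eqP p_prime => // ->.
- rewrite lead_coefE size_shifted_cyclotomic coef_poly prednK ?prime_gt0 //.
  rewrite leqnn binn dvdz1 /=; apply: contraTneq p_prime => p1.
  by rewrite -[p]/(absz p) p1.
- rewrite coef_poly prime_gt0 // bin1 natz dvdzE /= natrXE.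
  by rewrite -{2}[p]expn1 dvdn_Pexp2l ?(prime_gt1 p_prime).
- rewrite size_shifted_cyclotomic => i lt_i; rewrite coef_poly.
  have lt_ip : (i < p)%N by lia.
  rewrite lt_ip natz dvdzE /= prime_dvd_bin //; lia.
Qed.

(** After the substitution X + 1, the polynomial P is divisible by X and by the
    irreducible shifted cyclotomic polynomial; these are coprime and their product
    has degree p. *)
Lemma prime_root_poly_eq0 (P : {poly rat}) :
    (size P <= p)%N -> root (map_poly ratr P) w -> root P 1 -> P = 0.
Proof.
move=> szP Pw P1; pose sX : {poly rat} := 'X + 1%:P.
pose Psi : {poly rat} := map_poly intr shifted_cyclotomic.
have sz_Psi : size Psi = p.
  rewrite size_map_inj_poly ?rmorph0 ?size_shifted_cyclotomic //.
  exact: intr_inj.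
have w_neq1 : w != 1.
  apply/eqP => w1; have := prime_gt1 p_prime.
  rewrite ltnNge; apply/negP/negPn.
  by apply: dvdn_leq => //; rewrite (prim_order_dvd w_prim) w1 expr1n.
have PsiE : 'X * Psi = sX ^+ p - 1.
  have /(congr1 (map_poly (intr : int -> rat))) := mulX_shifted_cyclotomic.
  rewrite rmorphM /= map_polyX rmorphB rmorphXn rmorphD /= map_polyX !rmorph1.
  by [].
have Psi_w : root (map_poly ratr Psi) (w - 1).
  have /(congr1 (fun q => (map_poly (ratr : rat -> K) q).[w - 1])) := PsiE.
  rewrite rmorphM rmorphB rmorphXn rmorphD /= map_polyX map_polyC /= !rmorph1.
  rewrite !hornerE subrK (prim_expr_order w_prim) subrr => /eqP.
  by rewrite mulf_eq0 subr_eq0 (negPf w_neq1) => /=; rewrite rootE.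
have Ps_w : root (map_poly ratr (P \Po sX)) (w - 1).
  rewrite map_comp_poly rmorphD /= map_polyX map_polyC /= rmorph1.
  by rewrite rootE horner_comp !hornerE subrK.
have Psi_dvd : Psi %| P \Po sX.
  have [_ irr] := shifted_cyclotomic_irreducible.
  have := irr (gcdp Psi (P \Po sX)); rewrite dvdp_gcdl => dvd_gcd.
  have : size (gcdp Psi (P \Po sX)) != 1%N.
    rewrite -(size_map_poly (ratr : rat -> K)) gcdp_map.
    apply/eqP => sz1; have : root (gcdp (map_poly (ratr : rat -> K) Psi)
                      (map_poly ratr (P \Po sX))) (w - 1).
      by rewrite root_gcd Psi_w Ps_w.
    have /eqP/size_poly1P[c c0 ->] := sz1.
    by rewrite rootC (negPf c0).
  move=> /dvd_gcd/(_ isT)/andP[_]; move=> /dvdp_trans; apply; exact: dvdp_gcdr.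
have X_dvd : 'X %| P \Po sX.
  by rewrite -['X]subr0 dvdp_XsubCl rootE horner_comp !hornerE; apply/eqP/rootP.
have cop : coprimep 'X Psi.
  rewrite -['X]subr0 coprimep_sym coprimep_XsubC rootE horner_coef0 coef_map.
  by rewrite coef_poly prime_gt0 // bin1 /= natz intr_eq0 -lt0n prime_gt0.
have := Gauss_dvdp (P \Po sX) cop; rewrite X_dvd Psi_dvd => XPsi_dvd.
have : P \Po sX = 0.
  apply/eqP; apply: contraTT XPsi_dvd => Ps0; apply: contraTN szP => /dvdp_leq.
  move=> /(_ Ps0); rewrite size_comp_poly2 ?size_XaddC // -ltnNge.
  rewrite size_mul ?polyX_eq0 ?size_polyX //; last first.
    by rewrite -size_poly_gt0 sz_Psi prime_gt0.
  by rewrite sz_Psi.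
move/eqP; rewrite -size_poly_eq0 size_comp_poly2 ?size_XaddC //.
by rewrite size_poly_eq0 => /eqP.
Qed.

End PrimeRoots.

(** The difference of the generating polynomials of the two bead sets vanishes
    at w because the sums agree, and at 1 because both sets have k elements. *)
Lemma bead_sum_inj (K : numFieldType) (k m : nat) (w z0 : K)
    (e e' : young k m) :
    prime (k + m) -> (k + m).-primitive_root w -> z0 != 0 ->
    \sum_a bead_point w z0 e a = \sum_a bead_point w z0 e' a ->
  e = e'.
Proof.
move=> p_prime w_prim z0_neq0; rewrite -!mulr_sumr => /(mulfI z0_neq0) eq_sum.
pose P (d : young k m) : {poly rat} := \sum_(a < k) 'X^(bead d a).
have P_w (d : young k m) : (map_poly ratr (P d)).[w] = \sum_(a < k) w ^+ bead d a.
  rewrite rmorph_sum horner_sum /=; apply: eq_bigr => a _.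
  by rewrite map_polyXn hornerXn.
have P_1 (d : young k m) : (P d).[1] = k%:R.
  rewrite horner_sum; under eq_bigr do rewrite hornerXn expr1n.
  by rewrite sumr_const card_ord.
have sz_P (d : young k m) : (size (P d) <= k + m)%N.
  apply: (leq_trans (size_sum _ _ _)); apply/bigmax_leqP => a _.
  by rewrite size_polyXn bead_lt.
have coefP (d : young k m) i : (P d)`_i = (#|[pred a : 'I_k | bead d a == i]|)%:R.
  rewrite coef_sum -sum1_card natr_sum [RHS]big_mkcond /=.
  by apply: eq_bigr => a _; rewrite coefXn eq_sym inE; case: eqP.
have eq_P : P e = P e'.
  apply/eqP; rewrite -subr_eq0; apply/eqP.
  apply: (prime_root_poly_eq0 p_prime w_prim).
  - by rewrite (leq_trans (size_polyD _ _)) // size_polyN geq_max !sz_P.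
  - by rewrite rootE rmorphB !hornerE !P_w eq_sum subrr.
  - by rewrite rootE !hornerE !P_1 subrr.
apply: bead_sub_inj => a.
have : (P e)`_(bead e a) != 0.
  by rewrite coefP pnatr_eq0 -lt0n; apply/card_gt0P; exists a; rewrite inE.
rewrite eq_P coefP pnatr_eq0 -lt0n => /card_gt0P[b]; rewrite inE => /eqP <-.
by exists b.
Qed.

Lemma c1_eigenvalue_inj (R : realType) (k n : nat) (w z0 : R[i]) :
    (k < n)%N -> n.-primitive_root w -> z0 != 0 -> prime n ->
  injective (@c1_eigenvalue R k n w z0).
Proof.
move=> k_lt w_prim z0_neq0 n_prime e e' /mulfI eq_sum.
have nE : (k + (n - k))%N = n by rewrite subnKC // ltnW.
have w_prim' : (k + (n - k)).-primitive_root w by rewrite nE.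
apply: (bead_sum_inj _ w_prim' z0_neq0); rewrite ?nE //.
by apply: eq_sum; rewrite pnatr_eq0 -lt0n (leq_ltn_trans _ k_lt).
Qed.

(** * Roots of unity in trigonometric form *)

Section UnitCircle.
Variable R : realType.
Implicit Types s t : R.

Definition expi t : R[i] := Complex (cos t) (sin t).

Lemma expi0 : expi 0 = 1.
Proof. by rewrite /expi cos0 sin0. Qed.

Lemma expiD s t : expi (s + t) = expi s * expi t.
Proof. by rewrite /expi cosD sinD; simpc; congr (_ +i* _)%C; ring. Qed.

Lemma expiN t : expi (- t) = (expi t)^*%C.
Proof. by rewrite /expi cosN sinN. Qed.

Lemma expiMn t j : expi (t *+ j) = expi t ^+ j.
Proof.
by elim: j => [|j IHj]; rewrite ?expi0 // mulrS exprS expiD IHj.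
Qed.

Lemma expi_pi : expi pi = -1.
Proof. by rewrite /expi cospi sinpi; simpc. Qed.

Lemma cos_le_of_norm s t : `|s| <= t -> t <= pi -> cos t <= cos s.
Proof.
move=> le_st le_tpi; have := normr_ge0 s; rewrite -(cos_norm s); move: `|s| le_st => u le_ut u_ge0.
by rewrite leNgt ltr_cos ?in_itv /= -?leNgt //; apply/andP; split; lra.
Qed.

Variable n : nat.
Hypothesis n_gt1 : (1 < n)%N.

Definition step : R := pi / n%:R.
Definition omega : R[i] := expi (step *+ 2).

Let n_neq0 : n%:R != 0 :> R. Proof. by rewrite pnatr_eq0; lia. Qed.

Lemma stepMn : step *+ n = pi.
Proof. by rewrite -mulr_natr divfK. Qed.

Lemma step_gt0 : 0 < step.
Proof. by rewrite divr_gt0 ?pi_gt0 // ltr0n; lia. Qed.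

Lemma stepM_ltpi j : (0 < j < n)%N -> 0 < step *+ j < pi.
Proof.
case/andP=> j_gt0 lt_jn; rewrite pmulrn_lgt0 // step_gt0 /=.
by rewrite -stepMn ltr_pMn2l ?step_gt0.
Qed.

Lemma sin_step_gt0 : 0 < sin step.
Proof. by have := @stepM_ltpi 1; rewrite n_gt1 => /(_ isT)/sin_gt0_pi. Qed.

(** For 0 < j < n, if the power j of omega were 1 then
    1 - 2 sin (j pi / n) ^ 2 = cos (2 j pi / n) = 1, whereas
    sin (j pi / n) > 0. *)
Lemma omega_prim : n.-primitive_root omega.
Proof.
rewrite /primitive_root_of_unity (ltnW n_gt1); apply/forallP => j.
rewrite unity_rootE /omega -expiMn -mulrnA.
have [->|ne_jn] := eqVneq j.+1 n.
  by rewrite mulnC mulrnA stepMn mulr2n expiD expi_pi mulrNN mulr1 eqxx.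
rewrite eqbF_neg mulnC mulrnA; apply/eqP => -[cos1 _].
have /sin_gt0_pi : 0 < step *+ j.+1 < pi.
  by apply: stepM_ltpi; have := ltn_ord j; lia.
by move: cos1; rewrite cos_mulr2n cos2sin2 => cos1; nra.
Qed.

Lemma cos_le_outside s t : 0 <= t -> t <= s -> s <= pi *+ 2 - t -> cos s <= cos t.
Proof.
move=> t_ge0 le_ts le_s; have [le_spi|lt_pis] := leP s pi.
  by apply: cos_le_of_norm => //; rewrite ger0_norm.
have -> : cos s = cos (pi *+ 2 - s).
  by rewrite -[RHS]cosN opprB -[in LHS](subrK (pi *+ 2) s) cosD2pi.
by apply: cos_le_of_norm; rewrite ?ger0_norm //; move: le_s; rewrite mulr2n; lra.
Qed.

Variable k : nat.
Hypotheses (k_gt0 : (0 < k)%N) (k_lt : (k < n)%N).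

(** The argument of the j-th root of x^n = (-1)^(k+1), numbered so that the
    roots 0, ..., k - 1 lie symmetrically about the positive real axis. *)
Definition centered_angle (j : nat) : R := step * (j%:R * 2 + 1 - k%:R).
Definition base_root : R[i] := expi (centered_angle 0).

Lemma base_root_omega j : base_root * omega ^+ j = expi (centered_angle j).
Proof.
rewrite /base_root /omega -expiMn -expiD; congr expi.
by rewrite /centered_angle -[_ *+ j]mulr_natr; ring.
Qed.

Lemma base_root_expr : base_root ^+ n = (-1) ^+ k.+1.
Proof.
rewrite /base_root -expiMn.
have -> : centered_angle 0 *+ n = pi + (- pi) *+ k.
  rewrite -[LHS]mulr_natr -[_ *+ k]mulr_natr -stepMn -[step *+ n]mulr_natr.
  by rewrite /centered_angle; ring.
by rewrite expiD expi_pi expiMn expiN expi_pi rmorphN1 -exprS.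
Qed.

(** Together with [cos_outside]: in every direction t within pi / n of the real
    axis, the level cos (k pi / n) weakly separates the first k roots from the
    others.  This uniform level is why consecutive roots have the largest sum. *)
Lemma cos_inside j t :
  (j < k)%N -> `|t| <= step -> cos (step * k%:R) <= cos (centered_angle j - t).
Proof.
move=> lt_jk; rewrite ler_norml => /andP[t_ge t_le]; have s_gt0 := step_gt0.
have lt_jkR : j%:R + 1 <= k%:R :> R by rewrite natr1 ler_nat.
have j_ge0 : 0 <= j%:R :> R by [].
have le_knR : k%:R <= n%:R :> R by rewrite ler_nat ltnW.
apply: cos_le_of_norm.
  have hi : step * 1 <= step * (k%:R * 2 - j%:R * 2 - 1) by rewrite ler_pM2l //; lra.
  have lo : step * 1 <= step * (j%:R * 2 + 1) by rewrite ler_pM2l //; lra.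
  by rewrite /centered_angle ler_norml; apply/andP; split; lra.
by rewrite -stepMn -[step *+ n]mulr_natr ler_pM2l.
Qed.

Lemma cos_outside j t :
  (k <= j < n)%N -> `|t| <= step ->
  cos (centered_angle j - t) <= cos (step * k%:R).
Proof.
case/andP=> le_kj lt_jn; rewrite ler_norml => /andP[t_ge t_le].
have s_gt0 := step_gt0.
have lt_jnR : j%:R + 1 <= n%:R :> R by rewrite natr1 ler_nat.
have le_kjR : k%:R <= j%:R :> R by rewrite ler_nat.
have k_ge0 : 0 <= k%:R :> R by [].
have lo : step * 1 <= step * (j%:R * 2 + 1 - k%:R * 2) by rewrite ler_pM2l //; lra.
have hi : step * 1 <= step * (n%:R * 2 - j%:R * 2 - 1) by rewrite ler_pM2l //; lra.
have pE : pi = step * n%:R by rewrite mulr_natr stepMn.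
rewrite /centered_angle; apply: cos_le_outside; rewrite ?pE ?mulr2n; [|lra|lra].
by rewrite mulr_ge0 // ltW.
Qed.

Definition radius : R := \sum_(j < k) cos (centered_angle j).

Lemma centered_angle_step j :
  (centered_angle j + step = step * (j.+1%:R * 2 - k%:R))
  * (centered_angle j - step = step * (j%:R * 2 - k%:R)).
Proof.
by split; rewrite /centered_angle -?[j.+1%:R]natr1; ring.
Qed.

(** Multiplied by 2 sin (pi / n), the sum telescopes; so does the sum of
    cosines in [radius_gt0]. *)
Lemma sum_sin_centered_angle : \sum_(j < k) sin (centered_angle j) = 0.
Proof.
apply: (mulfI (lt0r_neq0 sin_step_gt0)); apply: (@mulIf R 2); first by rewrite pnatr_eq0.
rewrite mulr0 mul0r mulr_sumr mulr_suml.
pose f j := - cos (step * (j%:R * 2 - k%:R)).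
transitivity (\sum_(0 <= j < k) (f j.+1 - f j)).
  rewrite big_mkord; apply: eq_bigr => j _; rewrite /f -!centered_angle_step.
  by rewrite cosD cosB; ring.
rewrite telescope_sumr // /f opprK /= mul0r sub0r mulrN cosN.
by rewrite (_ : k%:R * 2 - k%:R = k%:R :> R); ring.
Qed.

Lemma radius_gt0 : 0 < radius.
Proof.
have s_gt0 := sin_step_gt0.
suff : 0 < sin step * radius * 2 by rewrite pmulr_lgt0 // pmulr_rgt0.
rewrite mulr_sumr mulr_suml.
pose f j := sin (step * (j%:R * 2 - k%:R)).
have -> : \sum_(j < k) sin step * cos (centered_angle j) * 2
        = \sum_(0 <= j < k) (f j.+1 - f j).
  rewrite big_mkord; apply: eq_bigr => j _; rewrite /f -!centered_angle_step.
  by rewrite sinD sinB; ring.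
rewrite telescope_sumr // /f /= mul0r sub0r mulrN sinN opprK.
rewrite (_ : k%:R * 2 - k%:R = k%:R :> R); last by ring.
have : 0 < step *+ k < pi by apply: stepM_ltpi; rewrite k_gt0.
rewrite -[step *+ k]mulr_natr => /sin_gt0_pi sin_gt0.
by rewrite addr_gt0.
Qed.

End UnitCircle.

(** * Eigenvalues of maximal modulus *)

(** After subtracting the level c, the terms are nonnegative for j < k and
    nonpositive for the other j. *)
Lemma sum_le_top (R : numDomainType) (k n : nat) (h : nat -> R) (c : R)
    (f : 'I_k -> nat) :
    (k <= n)%N -> injective f -> (forall a, f a < n)%N ->
    (forall j, (j < k)%N -> c <= h j) ->
    (forall j, (k <= j < n)%N -> h j <= c) ->
  \sum_a h (f a) <= \sum_(j < k) h j.
Proof.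
move=> le_kn f_inj f_lt h_ge h_le; pose g a := Ordinal (f_lt a).
have g_inj : injective g by move=> a b /(congr1 val)/f_inj.
suff : \sum_a (h (f a) - c) <= \sum_(j < k) (h j - c).
  by rewrite !sumrB lerD2r.
rewrite (big_ord_widen _ (fun j => h j - c) le_kn).
have -> : \sum_a (h (f a) - c) = \sum_(j in [set g a | a : 'I_k]) (h j - c).
  by rewrite big_imset //= => a b _ _ /g_inj.
rewrite [leLHS]big_mkcond [leRHS]big_mkcond /=; apply: ler_sum => j _.
case: (ltnP j k) => [lt_jk|le_kj]; case: ifP => // _.
- by rewrite subr_ge0 h_ge.
- by rewrite subr_le0 h_le // le_kj ltn_ord.
Qed.

(** Here c and s are the cosine and sine of pi / n, and (x, y) is a point whose
    real part does not increase under rotation by 2 pi / n in either sense; this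
    puts it in the cone of half-angle pi / n about the positive real axis.  There
    its direction is a nonnegative combination of the real axis and one edge of
    the cone, and the support inequalities for these give x^2 + y^2 <= r x. *)
Lemma cone_point_max_modulus (R : realFieldType) (c s r x y : R) :
    c ^+ 2 + s ^+ 2 = 1 -> 0 < s -> 0 < r ->
    x ^+ 2 + y ^+ 2 = r ^+ 2 -> x <= r ->
    x * c + y * s <= r * c -> x * c - y * s <= r * c ->
    (c ^+ 2 *+ 2 - 1) * x - c * s *+ 2 * y <= x ->
    (c ^+ 2 *+ 2 - 1) * x + c * s *+ 2 * y <= x ->
  x = r /\ y = 0.
Proof.
move=> cs1 s_gt0 r_gt0 norm_xy le_x le_p le_m rot_p rot_m.
have cE : c ^+ 2 = 1 - s ^+ 2 by rewrite -cs1 addrK.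
have cone_p : 0 <= s * x + c * y.
  rewrite -(pmulr_rge0 _ s_gt0) -(pmulr_rge0 _ (ltr0Sn R 1)).
  by move: rot_p; rewrite cE; lra.
have cone_m : 0 <= s * x - c * y.
  rewrite -(pmulr_rge0 _ s_gt0) -(pmulr_rge0 _ (ltr0Sn R 1)).
  by move: rot_m; rewrite cE; lra.
(* For y >= 0, use s (x, y) = y (c, s) + (s x - c y) (1, 0). *)
have norm_le : x ^+ 2 + y ^+ 2 <= r * x.
  rewrite -(ler_pM2l s_gt0); have [y_ge0|y_lt0] := leP 0 y.
    have h1 : y * (x * c + y * s) <= y * (r * c) by rewrite ler_wpM2l.
    have h2 : (s * x - c * y) * x <= (s * x - c * y) * r by rewrite ler_wpM2l.
    lra.
  have h1 : - y * (x * c - y * s) <= - y * (r * c) by rewrite ler_wpM2l //; lra.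
  have h2 : (s * x + c * y) * x <= (s * x + c * y) * r by rewrite ler_wpM2l.
  lra.
have le_rx : r <= x by rewrite -(ler_pM2l r_gt0) -expr2 -norm_xy.
have xr : x = r by apply/eqP; rewrite eq_le le_x.
split=> //; apply/eqP; rewrite -sqrf_eq0; apply/eqP.
by apply: (addrI (x ^+ 2)); rewrite norm_xy xr addr0.
Qed.

Section MaximalModulus.
Variables (R : realType) (k n : nat).
Hypotheses (k_gt0 : (0 < k)%N) (k_lt : (k < n)%N).
Let n_gt1 : (1 < n)%N. Proof. exact: leq_ltn_trans k_lt. Qed.
Let n_gt0 : (0 < n)%N. Proof. exact: ltnW. Qed.
Local Notation w := (omega R n).
Local Notation z0 := (base_root R n k).
Local Notation spectrum := (c1_spectrum R k n).
Local Notation Re := (@complex.Re R).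
Local Notation Im := (@complex.Im R).
Local Notation step := (step R n).
Let w_prim : n.-primitive_root w. Proof. exact: omega_prim. Qed.
Let z0n : z0 ^+ n = (-1) ^+ k.+1. Proof. exact: base_root_expr. Qed.

Definition spectral_radius : R := n%:R * radius R n k.

Lemma spectral_radius_gt0 : 0 < spectral_radius.
Proof. by rewrite mulr_gt0 ?ltr0n ?radius_gt0. Qed.

Lemma sum_expi (I : finType) (f : I -> R) :
  n%:R * \sum_i expi (f i)
    = ((n%:R * \sum_i cos (f i)) +i* (n%:R * \sum_i sin (f i)))%C.
Proof.
have -> : \sum_i expi (f i) = ((\sum_i cos (f i)) +i* (\sum_i sin (f i)))%C.
  elim: (index_enum I) => [|i r IHr]; first by rewrite !big_nil.
  by rewrite !big_cons IHr /expi; simpc.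
by rewrite -[n%:R in LHS](rmorph_nat (real_complex R)); simpc.
Qed.

Lemma spectrum_rot a j : spectrum a -> spectrum (w ^+ j * a).
Proof.
move=> /(c1_spectrum_families k_gt0 k_lt w_prim z0n)[x [x_inj xn ->]].
apply/(c1_spectrum_families k_gt0 k_lt w_prim z0n).
exists (fun b => w ^+ j * x b); split=> [b c|b|].
- by move/mulfI => /(_ _)/x_inj; apply; rewrite expf_neq0 // (prim_root_neq0 w_prim).
- by rewrite exprMn -exprM mulnC exprM (prim_expr_order w_prim) expr1n mul1r.
- by rewrite mulrCA mulr_sumr.
Qed.

Lemma spectrum_conj a : spectrum a -> spectrum (a^*)%C.
Proof.
move=> /(c1_spectrum_families k_gt0 k_lt w_prim z0n)[x [x_inj xn ->]].
apply/(c1_spectrum_families k_gt0 k_lt w_prim z0n).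
exists (fun b => (x b)^*%C); split=> [b c|b|].
- by move/(can_inj (@conjcK R))/x_inj.
- by rewrite -rmorphXn xn rmorphXn rmorphN1.
- by rewrite rmorphM rmorph_nat rmorph_sum.
Qed.

Lemma spectrum_radius : spectrum (spectral_radius%:C)%C.
Proof.
apply/(c1_spectrum_families k_gt0 k_lt w_prim z0n).
exists (fun b : 'I_k => z0 * w ^+ b); split=> [b c|b|].
- move/mulfI => /(_ (sign_root_neq0 n_gt0 z0n))/eqP.
  rewrite (eq_prim_root_expr w_prim) !modn_small => [/eqP/val_inj //| |];
  exact: (ltn_trans (ltn_ord _)).
- by rewrite exprMn -exprM mulnC exprM (prim_expr_order w_prim) expr1n mulr1.
- under eq_bigr do rewrite base_root_omega.
  by rewrite sum_expi sum_sin_centered_angle // mulr0.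
Qed.

(** The component of an eigenvalue in the direction t is n times a sum of
    cosines over k roots, and by [sum_le_top] the first k roots maximize it. *)
Lemma spectrum_support a t :
    spectrum a -> `|t| <= step ->
  Re a * cos t + Im a * sin t <= spectral_radius * cos t.
Proof.
move=> /(c1_spectrumP k_gt0 k_lt w_prim z0n)[e ->] t_le.
rewrite /c1_eigenvalue; under eq_bigr do rewrite /bead_point base_root_omega.
rewrite sum_expi /spectral_radius /= -!mulrA -mulrDr ler_wpM2l //.
have cosBE (I : finType) (f : I -> R) :
    (\sum_i cos (f i)) * cos t + (\sum_i sin (f i)) * sin t
      = \sum_i cos (f i - t).
  by rewrite !mulr_suml -big_split; apply: eq_bigr => i _; rewrite cosB.
have -> : radius R n k * cos t = \sum_(j < k) cos (centered_angle R n k j - t).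
  by rewrite -cosBE sum_sin_centered_angle // mul0r addr0.
rewrite cosBE.
apply: (@sum_le_top _ k n (fun j => cos (centered_angle R n k j - t))
          (cos (step * k%:R)) (fun a => bead e a)).
- exact: ltnW.
- exact: bead_inj.
- by move=> b; have := bead_lt e b; rewrite subnKC // ltnW.
- by move=> j lt_jk; apply: cos_inside.
- by move=> j le_kj; apply: cos_outside.
Qed.

(** Among the rotations of a, one of largest real part satisfies the hypotheses
    of [cone_point_max_modulus] and is therefore the spectral radius itself. *)
Lemma spectrum_max_modulus a :
    spectrum a -> Re a ^+ 2 + Im a ^+ 2 = spectral_radius ^+ 2 ->
  exists j, a = (spectral_radius%:C)%C * w ^+ j.
Proof.
move=> Sa norm_a; pose i0 : 'I_n := Ordinal n_gt0.
case: (@arg_maxP _ _ _ i0 predT (fun i : 'I_n => Re (w ^+ i * a)) isT) => i _ i_max.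
have {}i_max j : Re (w ^+ j * a) <= Re (w ^+ i * a).
  rewrite -(prim_expr_mod w_prim).
  by apply: (i_max (Ordinal (ltn_pmod j n_gt0))).
set t := w ^+ i * a in i_max.
have St : spectrum t by apply: spectrum_rot.
have norm_t : Re t ^+ 2 + Im t ^+ 2 = spectral_radius ^+ 2.
  rewrite -norm_a /t -expiMn /expi; case: (a) => x y /=.
  have := cos2Dsin2 (step *+ 2 *+ i); set c := cos _; set s := sin _ => cs1.
  by rewrite -[RHS]mul1r -cs1; ring.
have r_gt0 := spectral_radius_gt0; have s_gt0 := sin_step_gt0 R n_gt1.
have st_ge0 : 0 <= step by rewrite ltW // step_gt0.
have le_x : Re t <= spectral_radius.
  have := @spectrum_support t 0 St; rewrite normr0 cos0 sin0 mulr0 addr0 !mulr1.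
  exact.
have le_plus : Re t * cos step + Im t * sin step <= spectral_radius * cos step.
  by apply: spectrum_support; rewrite // ger0_norm.
have le_minus : Re t * cos step - Im t * sin step <= spectral_radius * cos step.
  have := @spectrum_support t (- step) St.
  by rewrite cosN sinN mulrN normrN ger0_norm // lexx; apply.
have cs1 := cos2Dsin2 step.
have w_t : Re (w * t) <= Re t by rewrite mulrA -exprS.
have wV_t : Re (conjc w * t) <= Re t.
  have -> : conjc w = w ^+ n.-1.
    apply: (mulfI (prim_root_neq0 w_prim)).
    by rewrite -exprS prednK // (prim_expr_order w_prim) -expiN -expiD subrr expi0.
  by rewrite mulrA -exprD.
have tE : t = (spectral_radius%:C)%C.
  move: w_t wV_t; rewrite /omega /expi cos_mulr2n sin_mulr2n.
  case: t norm_t le_x le_plus le_minus {i_max St} => x y /= norm_t ? ? ?.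
  rewrite mulNr opprK => w_t wV_t.
  by case: (@cone_point_max_modulus R (cos step) (sin step) spectral_radius x y)
     => // -> ->.
exists (n - i)%N; rewrite -tE /t mulrAC -exprD subnKC 1?ltnW //.
by rewrite (prim_expr_order w_prim) mul1r.
Qed.

End MaximalModulus.

(** * The dihedral group in normal form *)

Section DihedralNormalForm.
Variable n : nat.
Hypothesis n_gt1 : (1 < n)%N.
Let n_gt0 : (0 < n)%N. Proof. exact: ltnW. Qed.

(** The exponent of x in x^i y^b x^j = x^(i +- j) y^b, where n - j stands for
    the inverse power. *)
Definition turn (i : 'I_n) (b : bool) (j : 'I_n) : 'I_n :=
  Ordinal (ltn_pmod (i + (if b then n - j else j))%N n_gt0).

(** The relations bring every element to the form x^i y^b with i < n and b < 2;
    there are 2 n such words and 2 n elements, so the form is unique. *)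
Lemma dihedral_normal_form :
  exists2 h : ('I_n * bool)%type -> 'D_(2 * n), bijective h &
    forall u v, (h u * h v)%g = h (turn u.1 u.2 v.1, u.2 (+) v.2).
Proof.
rewrite mul2n; have := Grp_dihedral n_gt1 => /isoGrp_hom.
case/existsP => -[x y] /= /eqP[gen_xy xn y2 xy].
pose h (u : ('I_n * bool)%type) : 'D_(n.*2) := (x ^+ u.1 * y ^+ u.2)%g.
have x_mod i : (x ^+ (i %% n) = x ^+ i)%g.
  by rewrite [in RHS](divn_eq i n) expgD mulnC expgM xn expg1n mul1g.
have xVn (j : 'I_n) : (x ^+ (n - j) = x ^- j)%g.
  apply/eqP; rewrite eq_sym eq_invg_mul -expgD subnKC ?xn // ltnW //.
have yx j (b : bool) : (y ^+ b * x ^+ j = (if b then x ^- j else x ^+ j) * y ^+ b)%g.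
  case: b; rewrite ?mul1g ?mulg1 // expg1.
  have yy : (y * y = 1)%g by rewrite -[RHS]y2.
  have yV : (y^-1 = y)%g by apply/eqP; rewrite eq_invg_mul yy.
  have -> : (x ^- j = (x ^+ j) ^ y)%g by rewrite conjXg xy expVgn.
  by rewrite conjgE yV -!mulgA yy mulg1.
have hM u v : (h u * h v)%g = h (turn u.1 u.2 v.1, u.2 (+) v.2).
  case: u v => [i b] [j c]; rewrite /h /= x_mod expgD -!mulgA; congr (_ * _)%g.
  rewrite !mulgA yx -mulgA; congr (_ * _)%g; first by case: b; rewrite ?xVn.
  by rewrite -expgD; case: b c => [] [] //; rewrite y2.
exists h => //.
have h_onto : h @: [set: ('I_n * bool)%type] = [set: 'D_(n.*2)].
  apply/eqP; rewrite -finset.subTset -gen_xy norm_joinEr; last first.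
    by rewrite cycle_subG inE -cycleJ xy cycleV.
  apply/fintype.subsetP => _ /mulsgP[_ _ /cycleP[i ->] /cycleP[j ->] ->].
  apply/imsetP; exists (Ordinal (ltn_pmod i n_gt0), odd j); rewrite // /h /= x_mod.
  by rewrite -[in LHS](odd_double_half j) expgD -(mul2n j./2) expgM y2 expg1n mulg1.
apply: inj_card_bij.
  suff /imset_injP h_inj : #|h @: [set: ('I_n * bool)%type]| == #|[set: ('I_n * bool)%type]|.
    by move=> u v; apply: h_inj; rewrite inE.
  by rewrite h_onto card_dihedral // cardsT card_prod card_ord card_bool muln2.
by rewrite -cardsT card_dihedral // card_prod card_ord card_bool muln2.
Qed.

End DihedralNormalForm.

(** * Linear isometries of the plane *)

Section PlaneIsometries.
Variable R : realType.
Local Notation Re := (@complex.Re R).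
Local Notation Im := (@complex.Im R).
Implicit Types (u z : R[i]) (b c : bool).

(** For u of modulus 1: the conjugation, if b holds, followed by the rotation
    by u. *)
Definition isometry_mx u b : 'M[R]_2 :=
  \matrix_(i < 2, j < 2)
    if j == ord0 then if i == ord0 then Re u else Im u
    else (-1) ^+ b * (if i == ord0 then - Im u else Re u).

Definition conj_if b z : R[i] := if b then conjc z else z.

Lemma eq_mx2 (A B : 'M[R]_2) :
  A 0 0 = B 0 0 -> A 0 1 = B 0 1 -> A 1 0 = B 1 0 -> A 1 1 = B 1 1 -> A = B.
Proof.
move=> e00 e01 e10 e11; apply/matrixP => i j.
have ord2 (l : 'I_2) : l = 0 \/ l = 1.
  by case: l => -[|[|//]] lt_l; [left | right]; apply/val_inj.
by case: (ord2 i) => ->; case: (ord2 j) => ->.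
Qed.

Lemma mulmx2E (A B : 'M[R]_2) i j : (A *m B) i j = A i 0 * B 0 j + A i 1 * B 1 j.
Proof.
by rewrite mxE big_ord_recl big_ord1; congr (_ + A i _ * B _ j); apply/val_inj.
Qed.

Lemma isometry_mx_act u b z : O2_act (isometry_mx u b) z = u * conj_if b z.
Proof.
case: u z => [p q] [x y]; rewrite /O2_act !mxE /= /conj_if.
by case: b => /=; simpc; congr (_ +i* _)%C; ring.
Qed.

Lemma isometry_mxM u b v c :
  isometry_mx u b *m isometry_mx v c = isometry_mx (u * conj_if b v) (b (+) c).
Proof.
case: u v => [p q] [x y].
apply: eq_mx2; rewrite mulmx2E !mxE /= /conj_if; case: b; case: c => /=; simpc; ring.
Qed.

Lemma isometry_mx_inj u b v c :
  u != 0 -> isometry_mx u b = isometry_mx v c -> u = v /\ b = c.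
Proof.
move=> u_neq0 eq_M; have e i j := congr1 (fun M : 'M[R]_2 => M i j) eq_M.
have eq_uv : u = v.
  apply/eqP; rewrite eq_complex; apply/andP; split; apply/eqP.
    by have := e 0 0; rewrite !mxE.
  by have := e 1 0; rewrite !mxE.
split=> //; apply: contraTeq u_neq0 => ne_bc; rewrite negbK eq_complex.
have := e 0 1; have := e 1 1; rewrite -eq_uv !mxE /=.
have -> : (-1) ^+ b = - (-1) ^+ c :> R.
  by case: b c ne_bc {e eq_M} => [] [] //= _; rewrite ?opprK.
by case: (c) => /=; rewrite ?expr0 ?expr1 => h1 h2; apply/andP; split;
   apply/eqP; lra.
Qed.

Lemma isometry_mx_O2 u b : Re u ^+ 2 + Im u ^+ 2 = 1 -> O2 (isometry_mx u b).
Proof.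
case: u => p q /= norm_u; rewrite /O2 /=.
by apply: eq_mx2; rewrite mulmx2E !mxE; case: b => /=; rewrite ?expr0 ?expr1; lra.
Qed.

(** The second column is orthogonal to the first and of length 1, hence it is
    the first column turned by a right angle times the determinant. *)
Lemma O2_isometry_mx (A : 'M[R]_2) :
  O2 A -> exists b, A = isometry_mx (A 0 0 +i* A 1 0)%C b.
Proof.
rewrite /O2 /= => /mulmx1C AtA.
have e i j := congr1 (fun M : 'M[R]_2 => M i j) AtA.
move: (e 0 0) (e 0 1) (e 1 1); rewrite !mulmx2E !mxE /= => {e}.
move e00 : (A 0 0) => p; move e01 : (A 0 1) => q; move e10 : (A 1 0) => r.
move e11 : (A 1 1) => s => h00 h01 h11.
(* The sign d is the determinant of A. *)
pose d := p * s - q * r.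
rewrite ?mulr1n ?mulr0n in h00 h01 h11.
have d2 : d ^+ 2 = 1.
  have -> : d ^+ 2 = (p * p + r * r) * (q * q + s * s) - (p * q + r * s) ^+ 2.
    by rewrite /d; ring.
  by rewrite h00 h01 h11 expr0n subr0 mulr1.
have qE : q = - r * d.
  have -> : - r * d = q * (p * p + r * r) - p * (p * q + r * s) by rewrite /d; ring.
  by rewrite h00 h01 mulr1 mulr0 subr0.
have sE : s = p * d.
  have -> : p * d = s * (p * p + r * r) - r * (p * q + r * s) by rewrite /d; ring.
  by rewrite h00 h01 mulr1 mulr0 subr0.
have /eqP := d2; rewrite sqrf_eq1 => /orP[] /eqP d1; [exists false | exists true];
  apply: eq_mx2; rewrite !mxE ?e00 ?e01 ?e10 ?e11 //= (qE, sE) d1; ring.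
Qed.

End PlaneIsometries.

(** * The stabilizer of the spectrum *)

Section Stabilizer.
Variables (R : realType) (k n : nat).
Hypotheses (k_gt0 : (0 < k)%N) (k_lt : (k < n)%N).
Let n_gt1 : (1 < n)%N. Proof. exact: leq_ltn_trans k_lt. Qed.
Local Notation w := (omega R n).
Local Notation spectrum := (c1_spectrum R k n).
Let w_prim : n.-primitive_root w. Proof. exact: omega_prim. Qed.

Lemma norm_omegaX j : complex.Re (w ^+ j) ^+ 2 + complex.Im (w ^+ j) ^+ 2 = 1.
Proof. by rewrite -expiMn cos2Dsin2. Qed.

Lemma conj_omegaX j : (j <= n)%N -> conjc (w ^+ j) = w ^+ (n - j).
Proof.
move=> le_jn; apply: (mulfI (expf_neq0 j (prim_root_neq0 w_prim))).
by rewrite -exprD subnKC // (prim_expr_order w_prim) -expiMn -expiN -expiD subrr expi0.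
Qed.

Lemma spectrum_isometry (i : 'I_n) (b : bool) a :
  spectrum a -> spectrum (w ^+ i * conj_if b a).
Proof.
move=> Sa; apply: (spectrum_rot k_gt0 k_lt).
by case: b; [apply: (spectrum_conj k_gt0 k_lt) | ].
Qed.

(** An isometry of the spectrum sends the spectral radius to an eigenvalue of
    the same modulus, that is to one of its rotations by powers of omega; this
    determines the first column of its matrix. *)
Lemma stabilizer_c1_spectrum (A : 'M[R]_2) :
  O2_stabilizer spectrum A <-> exists i : 'I_n, exists b, A = isometry_mx (w ^+ i) b.
Proof.
split=> [[A_O2 AS]|[i [b ->]]]; last first.
  split; first exact/isometry_mx_O2/norm_omegaX.
  apply/seteqP; split=> [_ [a Sa <-]|a Sa].
    by rewrite isometry_mx_act; apply: spectrum_isometry.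
  exists (conj_if b (w ^+ (n - i) * a)).
    have Sra := spectrum_rot k_gt0 k_lt (n - i) Sa.
    by case: b; [apply: (spectrum_conj k_gt0 k_lt) | ].
  rewrite isometry_mx_act; have -> : conj_if b (conj_if b (w ^+ (n - i) * a)) = w ^+ (n - i) * a.
    by case: b => //=; rewrite conjcK.
  by rewrite mulrA -exprD subnKC 1?ltnW // (prim_expr_order w_prim) mul1r.
have [b AE] := O2_isometry_mx A_O2; set u := (_ +i* _)%C in AE.
have r_neq0 := lt0r_neq0 (spectral_radius_gt0 R k_gt0 k_lt).
set r := spectral_radius R k n in r_neq0.
have Ar : O2_act A (r%:C)%C = u * (r%:C)%C.
  by rewrite AE isometry_mx_act; case: (b) => //=; rewrite oppr0.
have Sur : spectrum (u * (r%:C)%C).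
  by rewrite -Ar -AS; exists (r%:C)%C; first exact: spectrum_radius.
have norm_u : complex.Re u ^+ 2 + complex.Im u ^+ 2 = 1.
  have /mulmx1C/(congr1 (fun M : 'M[R]_2 => M 0 0)) := A_O2.
  by rewrite mulmx2E !mxE /= => h; rewrite !expr2.
have [|j /eqP] := spectrum_max_modulus k_gt0 k_lt Sur.
  rewrite -[RHS]mul1r -norm_u -/r; case: (u) => p q /=; ring.
rewrite mulrC (inj_eq (mulfI _)); last by rewrite eq_complex /= eqxx andbT.
move=> /eqP uE; exists (Ordinal (ltn_pmod j (ltnW n_gt1))), b.
by rewrite AE uE /= (prim_expr_mod w_prim).
Qed.

Lemma stabilizer_isog_dihedral :
  mx_group_isog 'D_(2 * n) (O2_stabilizer spectrum).
Proof.
have [h [g hK gK] hM] := dihedral_normal_form n_gt1.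
exists (fun x => isometry_mx (w ^+ (g x).1) (g x).2); split.
- move=> x y /isometry_mx_inj[]; first exact/expf_neq0/(prim_root_neq0 w_prim).
  move=> /eqP; rewrite (eq_prim_root_expr w_prim) !modn_small // => /eqP/val_inj eq1 eq2.
  by rewrite -[x]gK -[y]gK [g x]surjective_pairing eq1 eq2 -surjective_pairing.
- move=> x y; rewrite isometry_mxM -{1 2}[x]gK -{1 2}[y]gK hM hK /=.
  congr isometry_mx; rewrite (prim_expr_mod w_prim) exprD /conj_if.
  by case: ifP => // _; rewrite conj_omegaX // ltnW.
- apply/seteqP; split=> [_ [x _ <-]|A /stabilizer_c1_spectrum[i [b ->]]].
    by apply/stabilizer_c1_spectrum; exists (g x).1, (g x).2.
  by exists (h (i, b)); rewrite // hK.
Qed.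

End Stabilizer.

(** * The theorem *)

Local Open Scope complex_scope.
Local Open Scope classical_set_scope.

Theorem proposition1p12 (R : realType) (k n : nat) (hk : (1 <= k <= n - 1)%N) :
  [/\ c1_spectrum R k n
        = [set n%:R * \sum_(z <- Z) z | Z in [set Z : {fset R[i]} | root_set k n Z]],
      mx_group_isog 'D_(2 * n) (O2_stabilizer (c1_spectrum R k n))
    & prime n ->
        forall a : R[i], c1_spectrum R k n a -> c1_multiplicity R k n a = 1%N].
Proof.
have k_gt0 : (0 < k)%N by case/andP: hk.
have k_lt : (k < n)%N by lia.
have w_prim := omega_prim R (leq_ltn_trans k_gt0 k_lt).
have z0n := base_root_expr R (leq_ltn_trans k_gt0 k_lt) k.
split.
- apply/seteqP; split=> a.
    by move/(c1_spectrum_families k_gt0 k_lt w_prim z0n)/root_sets_families.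
  by move/root_sets_families/(c1_spectrum_families k_gt0 k_lt w_prim z0n).
- exact: stabilizer_isog_dihedral.
- move=> n_prime a; apply: (c1_multiplicity1 k_gt0 k_lt w_prim z0n).
  apply: (c1_eigenvalue_inj k_lt w_prim _ n_prime).
  exact: sign_root_neq0 (ltnW (leq_ltn_trans k_gt0 k_lt)) z0n.
Qed.
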